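(* Let $G_K$ be a finite group of order $K$, and let $\{D^\alpha\}_\alpha$ be a complete set of pairwise inequivalent irreducible unitary representations of $G_K$, $D^\alpha$ acting on $\mathbb{C}^{n_\alpha}$. Let $\varphi:G_K\to\mathbb{C}$ be a positive-type function with $\varphi(e)=1$, where $e$ is the identity of $G_K$. Then there exist real numbers $\gamma^\alpha\ge0$ with $\sum_\alpha\gamma^\alpha=1$ and density states $\rho^\alpha$ on $\mathbb{C}^{n_\alpha}$ such that for all $g\in G_K$ $$\varphi(g)=\sum_\alpha\gamma^\alpha\varphi^\alpha(g),\qquad \varphi^\alpha(g)=\mathrm{Tr}\left[\rho^\alpha D^\alpha(g)\right].$$
   Context: A density state is a Hermitian, positive semidefinite operator of trace one. A function $\varphi$ on a group $G$ is of positive type if for every $k\in\mathbb{N}$ and every $k$-tuple $(h_1,\dots,h_k)$ of elements of $G$ the $k\times k$ matrix with entries $\varphi(h_i^{-1}h_j)$ is positive semidefinite. *)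

(* Defs.v *)
From mathcomp Require Import all_boot all_order all_fingroup all_algebra.
From mathcomp Require Import spectral sesquilinear mxrepresentation.
From mathcomp Require Import complex reals.

Set Implicit Arguments.
Unset Strict Implicit.
Unset Printing Implicit Defensive.

Import GRing.Theory Num.Theory.

Local Open Scope ring_scope.
Local Open Scope sesquilinear_scope.

(* In a numClosedFieldType, [0 <= z] entails that z is real. *)
Definition psdmx (C : numClosedFieldType) (n : nat) (A : 'M[C]_n) : Prop :=
  A \is hermsymmx /\ forall v : 'cV[C]_n, 0 <= (v ^t* *m A *m v) 0 0.

Definition density_state (C : numClosedFieldType) (n : nat) (rho : 'M[C]_n) :
    Prop :=
  psdmx rho /\ \tr rho = 1.

(* Functions on G are represented by functions on the ambient type gT; only
   their values on G matter. *)
Definition positive_type (C : numClosedFieldType) (gT : finGroupType)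
    (G : {group gT}) (phi : gT -> C) : Prop :=
  forall (k : nat) (h : 'I_k -> gT), (forall i, h i \in G) ->
    psdmx (\matrix_(i < k, j < k) phi ((h i)^-1 * h j)%g).

Definition unitary_repr (C : numClosedFieldType) (gT : finGroupType)
    (G : {group gT}) (n : nat) (rG : mx_representation C G n) : Prop :=
  forall g, g \in G -> rG g \is unitarymx.

(* [mx_irreducible] and [mx_rsim] let matrices act on row vectors; for unitary
   representations irreducibility and equivalence do not depend on this. *)
Definition complete_unitary_irreps (C : numClosedFieldType)
    (gT : finGroupType) (G : {group gT}) (I : finType) (n : I -> nat)
    (D : forall a : I, mx_representation C G (n a)) : Prop :=
  [/\ forall a, unitary_repr (D a),
      forall a, mx_irreducible (D a),
      forall a b, a <> b -> ~ mx_rsim (D a) (D b)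
    & forall (m : nat) (rG : mx_representation C G m),
        unitary_repr rG -> mx_irreducible rG -> exists a, mx_rsim rG (D a)].

(* Main.v *)
(* Fourier analysis on G: put S_a = sum_x phi(x) D^a(x^-1). As
   sum_a n_a tr D^a is the character |G| delta_e of the regular representation,
   phi(g) = |G|^-1 sum_a n_a tr (S_a D^a(g)). Each S_a is positive semidefinite
   because phi is of positive type, so gamma^a = n_a tr S_a / |G| and
   rho^a = S_a / tr S_a; where tr S_a = 0 one has S_a = 0 and any density state
   will do. *)
Require Import Defs.
From mathcomp Require Import all_boot all_order all_fingroup all_algebra.
From mathcomp Require Import pgroup.
From mathcomp Require Import spectral sesquilinear mxrepresentation.
From mathcomp Require Import complex reals.

Set Implicit Arguments.
Unset Strict Implicit.
Unset Printing Implicit Defensive.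

Import Order.TTheory GRing.Theory Num.Theory.

Local Open Scope ring_scope.
Local Open Scope sesquilinear_scope.

(** * Regular representation and the weighted sum of irreducible characters *)

Lemma mxtrace_regular_repr (F : fieldType) (gT : finGroupType)
    (G : {group gT}) (x : gT) :
  x \in G -> \tr (regular_repr F G x) = #|G|%:R * (x == 1%g)%:R.
Proof.
move=> Gx; rewrite /mxtrace -[#|G|%:R]mulr1n.
(* Right multiplication by [x] fixes either every group element or none, so all diagonal entries
   agree. *)
transitivity (\sum_(i < #|G|) (x == 1%g)%:R : F).
  apply: eq_bigr => i _; rewrite !mxE eqxx /=; congr ((nat_of_bool _)%:R).
  rewrite -(inj_eq enum_val_inj) gring_indexK ?groupM ?enum_valP //.
  by rewrite eq_sym -[X in _ == X]mulg1 (inj_eq (mulgI _)).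
by rewrite sumr_const card_ord mulr_natl.
Qed.

Lemma adjmxM (C : numClosedFieldType) (m n p : nat)
    (A : 'M[C]_(m, n)) (B : 'M[C]_(n, p)) :
  (A *m B) ^t* = B ^t* *m A ^t*.
Proof. by rewrite trmx_mul map_mxM. Qed.

Lemma regular_repr_unitary (C : numClosedFieldType) (gT : finGroupType)
    (G : {group gT}) : unitary_repr (regular_repr C G).
Proof.
move=> x Gx; apply/unitarymxP/matrixP=> i j; rewrite !mxE.
under eq_bigr do rewrite !mxE !eqxx /= rmorph_nat.
rewrite (bigD1 (gring_index G (enum_val i * x)%g)) //= eqxx mul1r big1.
  rewrite addr0; congr ((nat_of_bool _)%:R).
  rewrite -(inj_eq enum_val_inj) !gring_indexK ?groupM ?enum_valP //.
  by rewrite (inj_eq (mulIg _)) (inj_eq enum_val_inj).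
by move=> k /negPf->; rewrite mul0r.
Qed.

(* Completeness only covers unitary irreducibles, so the components of the
   regular representation are made unitary via an orthonormal basis. *)
Lemma unitary_submod_repr (C : numClosedFieldType) (gT : finGroupType)
    (G : {group gT}) (n : nat) (rG : mx_representation C G n) (U : 'M[C]_n)
    (modU : mxmodule rG U) :
    unitary_repr rG ->
  exists2 rU : mx_representation C G (\rank U),
    unitary_repr rU & mx_rsim (submod_repr modU) rU.
Proof.
move=> unitG; pose B := schmidt (row_base U).
have uB: B \is unitarymx by rewrite schmidt_unitarymx ?rank_leq_row.
have BB : B *m B ^t* = 1%:M by apply/unitarymxP.
have defB: (B :=: U)%MS.
  apply: eqmx_trans (eq_row_base U).
  by apply: eqmx_schmidt_free; rewrite ?row_base_free.
(* As the rows of [B] are orthonormal, [B ^t* *m B] is the orthogonal projection onto [U]; stability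
   of [U] under [G] then makes the compression of [rG] to [U] multiplicative. *)
have projB m (W : 'M_(m, n)) : (W <= U)%MS -> W *m B ^t* *m B = W.
  by rewrite -defB => /submxP[V ->]; rewrite -mulmxA -mulmxA (mulmxA B) BB mul1mx.
have BG x : x \in G -> B *m rG x *m B ^t* *m B = B *m rG x.
  by move=> Gx; rewrite projB // mxmodule_trans // defB.
have reprB : mx_repr G (fun x => B *m rG x *m B ^t*).
  split=> [|x y Gx Gy]; first by rewrite repr_mx1 mulmx1.
  by rewrite repr_mxM // !mulmxA BG.
exists (MxRepresentation reprB) => [x Gx|] /=.
  apply/unitarymxP; rewrite !adjmxM trmxCK !mulmxA BG // -(mulmxA B).
  by rewrite (unitarymxP (unitG x Gx)) mulmx1.
(* The intertwiner holds the coordinates of [row_base U] in the orthonormal basis [B]. *)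
exists (row_base U *m B ^t*) => // [|x Gx /=].
  rewrite -row_leq_rank -{1}(eqP (row_base_free U)).
  by rewrite -{1}(projB _ (row_base U)) ?eq_row_base ?mxrankM_maxl.
rewrite !mulmxA projB ?eq_row_base //; congr (_ *m _).
rewrite -mulmxA; have := val_submodJ modU 1%:M Gx.
by rewrite /val_submod /= !mul1mx.
Qed.

(** The regular representation contains each irreducible as often as its degree. It remains to match
    [I] with the library's index set [sG]: completeness makes [h] surjective, pairwise inequivalence
    makes it injective. *)
Lemma sum_irr_mxtrace (C : numClosedFieldType) (gT : finGroupType)
    (G : {group gT}) (I : finType) (n : I -> nat)
    (D : forall a : I, mx_representation C G (n a)) (x : gT) :
    complete_unitary_irreps D -> x \in G ->
  \sum_a (n a)%:R * \tr (D a x) = #|G|%:R * (x == 1%g)%:R.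
Proof.
move=> [_ irrD neqD allD] Gx.
have C'G : ([pchar C]^'.-group G)%g.
  by apply/pgroupP=> p _ _; rewrite inE /= pchar_num.
pose sG : irrType C G := DecSocleType (regular_repr C G).
pose h a := irr_comp sG (D a).
have simD a : mx_rsim (D a) (irr_repr (h a)) by apply: rsim_irr_comp_pchar.
have surj_h i : exists a, h a == i.
  have [rU uU simU] :=
    unitary_submod_repr (socle_module i) (@regular_repr_unitary C gT G).
  have [a simUa] := allD _ _ uU (mx_rsim_irr simU (socle_irr i)).
  exists a; rewrite eq_sym; apply/socle_rsimP.
  exact: mx_rsim_trans simU (mx_rsim_trans simUa (simD a)).
have inj_h : injective h.
  move=> a b eq_h; apply/eqP/negPn/negP=> /eqP /neqD; apply.
  by apply: mx_rsim_trans (simD a) _; rewrite eq_h; apply/mx_rsim_sym/simD.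
rewrite -mxtrace_regular_repr //.
rewrite (mxtrace_regular_pchar sG C'G (@group_closure_closed_field C gT G)) //.
have [h' hK h'K] : bijective h.
  have hK i : h (xchoose (surj_h i)) = i by apply/eqP/(xchooseP (surj_h i)).
  by exists (fun i => xchoose (surj_h i)) => // a; apply: inj_h; rewrite hK.
rewrite (reindex h) /=; last by exists h' => i _.
apply: eq_bigr => a _; rewrite mulr_natl (mxtrace_rsim (simD a)) //.
by have [B def_n _ _] := simD a; rewrite def_n.
Qed.

(** * Fourier coefficients: positivity and inversion *)

(** Averaging over translations turns a single sum over the group into the double sum of a quadratic
    form in the kernel [phi (x^-1 * y)]. *)
Lemma sum_groupVM (V : nmodType) (gT : finGroupType) (G : {group gT})
    (f : gT -> V) :
  \sum_(x in G) \sum_(y in G) f (x^-1 * y)%g = (\sum_(y in G) f y) *+ #|G|.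
Proof.
rewrite -sumr_const; apply: eq_bigr => x Gx.
rewrite (reindex_inj (mulgI x)) /=.
by apply: eq_big => y; rewrite ?groupMl // mulKg.
Qed.

(** This is Hermitian symmetry of the 2 by 2 matrix attached to the pair (1, x). *)
Lemma positive_typeV (C : numClosedFieldType) (gT : finGroupType)
    (G : {group gT}) (phi : gT -> C) (x : gT) :
  positive_type G phi -> x \in G -> phi x^-1%g = (phi x)^*.
Proof.
move=> phi_pos Gx; pose h (i : 'I_2) := if i == 0 then 1%g else x.
have [|/is_hermitianmxP/matrixP/(_ 1 0) + _] := phi_pos _ h.
  by move=> i; rewrite /h; case: ifP.
by rewrite expr0 scale1r !mxE /h /= invg1 mulg1 mul1g.
Qed.

Lemma unitary_reprV (C : numClosedFieldType) (gT : finGroupType)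
    (G : {group gT}) (n : nat) (rG : mx_representation C G n) (x : gT) :
  unitary_repr rG -> x \in G -> rG x^-1%g = (rG x) ^t*.
Proof. by move=> uG Gx; rewrite repr_mxV // invmx_unitary // uG. Qed.

Definition fourier_mx (C : numClosedFieldType) (gT : finGroupType)
    (G : {group gT}) (phi : gT -> C) (n : nat)
    (rG : mx_representation C G n) : 'M[C]_n :=
  \sum_(x in G) phi x *: rG x^-1%g.

Lemma psd_fourier_mx (C : numClosedFieldType) (gT : finGroupType)
    (G : {group gT}) (phi : gT -> C) (n : nat)
    (rG : mx_representation C G n) :
  unitary_repr rG -> positive_type G phi -> psdmx (fourier_mx phi rG).
Proof.
move=> uG phi_pos; split.
  apply/is_hermitianmxP; rewrite expr0 scale1r /fourier_mx.
  rewrite raddf_sum /= raddf_sum /= (reindex_inj invg_inj) /=.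
  apply: eq_big => [x|x]; rewrite ?groupV // => Gx.
  rewrite (positive_typeV phi_pos) // unitary_reprV ?groupV //.
  by rewrite linearZ /= map_mxZ.
(* [|G| v^* S v = sum_r w_r^* Phi w_r], with [Phi] the matrix of [phi] on all
   of [G] and [w_r] the r-th column of the matrix [W] with rows
   [v^* rG(h_j^-1)]. *)
move=> v; pose h (i : 'I_#|G|) : gT := enum_val i.
have Gh i : h i \in G by apply: enum_valP.
have [_ Phi_ge0] := phi_pos _ h Gh; set Phi := (\matrix_(i, j) _) in Phi_ge0.
pose q x : C := phi x * (v ^t* *m rG x^-1%g *m v) 0 0.
pose W := \matrix_(j < #|G|) (v ^t* *m rG (h j)^-1%g).
have WW i j : (W *m W ^t*) j i = (v ^t* *m rG ((h i)^-1 * h j)^-1%g *m v) 0 0.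
  transitivity ((row j W *m (row i W) ^t*) 0 0).
    by rewrite !mxE; apply: eq_bigr => k _; rewrite !mxE.
  rewrite !rowK adjmxM trmxCK -unitary_reprV ?groupV // invgK.
  by rewrite invMg invgK repr_mxM ?groupV // !mulmxA.
clearbody W.
have -> : (v ^t* *m fourier_mx phi rG *m v) 0 0 = \sum_(x in G) q x.
  rewrite /fourier_mx mulmx_sumr mulmx_suml summxE; apply: eq_bigr => x _.
  by rewrite -scalemxAr -scalemxAl mxE.
suff: 0 <= (\sum_(x in G) q x) *+ #|G| by rewrite pmulrn_lge0.
rewrite -sum_groupVM big_enum_val.
under eq_bigr do rewrite big_enum_val.
suff -> : \sum_i \sum_j q ((h i)^-1 * h j)%g =
    \sum_r ((col r W) ^t* *m Phi *m col r W) 0 0 by apply: sumr_ge0.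
(* Both sides are expanded into triple sums over i, j and r, then reordered to have r innermost. *)
under eq_bigr do under eq_bigr do rewrite /q -WW mxE big_distrr /=.
under [RHS]eq_bigr => r _.
  rewrite mxE; under eq_bigr do rewrite mxE big_distrl /=.
  rewrite exchange_big; over.
rewrite [RHS]exchange_big; apply: eq_bigr => i _ /=.
rewrite [RHS]exchange_big; apply: eq_bigr => j _; apply: eq_bigr => r _ /=.
by rewrite !mxE mulrCA mulrC (mulrC (phi _)).
Qed.

Lemma fourier_inversion (C : numClosedFieldType) (gT : finGroupType)
    (G : {group gT}) (I : finType) (n : I -> nat)
    (D : forall a : I, mx_representation C G (n a)) (phi : gT -> C) (g : gT) :
    complete_unitary_irreps D -> g \in G ->
  \sum_a (n a)%:R * \tr (fourier_mx phi (D a) *m D a g) = #|G|%:R * phi g.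
Proof.
move=> cD Gg.
under eq_bigr => a _.
  rewrite mulmx_suml raddf_sum mulr_sumr /=.
  under eq_bigr => x Gx.
    rewrite -scalemxAl mxtraceZ -repr_mxM ?groupV // mulrCA; over.
  over.
(* The coefficient of [phi x] is now the weighted character sum at [x^-1 * g], which vanishes unless
   x = g. *)
rewrite exchange_big (bigD1 g) //= -mulr_sumr sum_irr_mxtrace ?groupM ?groupV //.
rewrite mulVg eqxx mulr1 mulrC big1 ?addr0 // => x /andP[Gx neq_xg].
rewrite -mulr_sumr sum_irr_mxtrace ?groupM ?groupV //.
by rewrite -eq_mulVg1 (negPf neq_xg) !mulr0.
Qed.

(** * Positive semidefinite matrices and their traces *)

Lemma psdmx_scale (C : numClosedFieldType) (n : nat) (c : C) (A : 'M[C]_n) :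
  0 <= c -> psdmx A -> psdmx (c *: A).
Proof.
move=> c_ge0 [/is_hermitianmxP hA A_ge0]; split=> [|v]; last first.
  by rewrite -scalemxAr -scalemxAl mxE mulr_ge0.
apply/is_hermitianmxP; rewrite [in LHS]hA !expr0 !scale1r linearZ /= map_mxZ.
congr (_ *: _).
by apply/esym/CrealP/ger0_real.
Qed.

Lemma psdmx1 (C : numClosedFieldType) (n : nat) : psdmx (1%:M : 'M[C]_n).
Proof.
split=> [|v]; first by apply/is_hermitianmxP; rewrite expr0 scale1r trmx1 map_mx1.
rewrite mulmx1 mxE sumr_ge0 // => i _.
by rewrite !mxE mulrC -normCK exprn_ge0.
Qed.

Lemma form_delta_mx (C : numClosedFieldType) (n : nat) (A : 'M[C]_n)
    (i j : 'I_n) :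
  ((delta_mx i 0 : 'cV_n) ^t* *m A *m (delta_mx j 0 : 'cV_n)) 0 0 = A i j.
Proof. by rewrite trmx_delta map_delta_mx -rowE -colE !mxE. Qed.

Lemma psdmx_diag_ge0 (C : numClosedFieldType) (n : nat) (A : 'M[C]_n)
    (i : 'I_n) :
  psdmx A -> 0 <= A i i.
Proof. by move=> [_ A_ge0]; rewrite -form_delta_mx A_ge0. Qed.

Lemma psdmx_mxtrace_ge0 (C : numClosedFieldType) (n : nat) (A : 'M[C]_n) :
  psdmx A -> 0 <= \tr A.
Proof. by move=> psdA; apply: sumr_ge0 => i _; apply: psdmx_diag_ge0. Qed.

(** Nonnegative diagonal entries with sum zero all vanish; positivity on vectors supported on two
    coordinates then kills the other entries. *)
Lemma psdmx_mxtrace_eq0 (C : numClosedFieldType) (n : nat) (A : 'M[C]_n) :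
  psdmx A -> \tr A = 0 -> A = 0.
Proof.
move=> psdA trA0.
have diag0 i : A i i = 0.
  apply: (psumr_eq0P (P := predT) _ trA0) => // j _; exact: psdmx_diag_ge0.
have [/is_hermitianmxP/matrixP hA A_ge0] := psdA.
apply/matrixP=> i j; rewrite [RHS]mxE; apply/eqP; rewrite -normr_eq0 -sqrf_eq0.
rewrite eq_le exprn_ge0 // andbT.
(* Testing positivity on [e_i - conj (A i j) e_j] gives [-2 |A i j|^2 >= 0]. *)
pose e k : 'cV[C]_n := delta_mx k 0; pose c := (A i j)^*.
have adj_e : (e i - c *: e j) ^t* = (e i) ^t* - A i j *: (e j) ^t*.
  by apply/matrixP=> k l; rewrite !mxE rmorphB rmorphM /= conjCK.
have := A_ge0 (e i - c *: e j); rewrite adj_e.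
rewrite !(mulmxBl, mulmxBr) -!(scalemxAl, scalemxAr).
have form_e k l : (e k) ^t* *m A *m e l = (A k l)%:M.
  by rewrite [LHS]mx11_scalar form_delta_mx.
have -> : c = A j i by rewrite [RHS]hA expr0 scale1r !mxE.
rewrite !form_e !diag0 !mxE /= !mulr1n !mulr0 subr0 sub0r (mulrC (A j i)).
rewrite -opprD oppr_ge0 -mulr2n pmulrn_lle0 //.
by rewrite (hA j i) expr0 scale1r !mxE -normCK.
Qed.

(** * Decomposition and normalization *)

Lemma psd_decomposition (C : numClosedFieldType) (gT : finGroupType)
    (G : {group gT}) (I : finType) (n : I -> nat)
    (D : forall a : I, mx_representation C G (n a)) (phi : gT -> C) :
    complete_unitary_irreps D -> positive_type G phi ->
  exists sigma : forall a, 'M[C]_(n a),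
    (forall a, psdmx (sigma a)) /\
    forall g, g \in G -> phi g = \sum_a \tr (sigma a *m D a g).
Proof.
move=> cD phi_pos; have [uD _ _ _] := cD.
exists (fun a => ((n a)%:R / #|G|%:R) *: fourier_mx phi (D a)); split=> [a | g Gg].
  by apply: psdmx_scale; [rewrite divr_ge0 ?ler0n | apply: psd_fourier_mx].
have nzG : #|G|%:R != 0 :> C by rewrite pnatr_eq0 -lt0n cardG_gt0.
apply: (mulfI nzG); rewrite -(fourier_inversion phi cD Gg) mulr_sumr.
apply: eq_bigr => a _.
by rewrite -scalemxAl mxtraceZ mulrA mulrCA mulfV // mulr1.
Qed.

Lemma psdmx_density_state (C : numClosedFieldType) (n : nat) (A : 'M[C]_n) :
    (0 < n)%N -> psdmx A ->
  exists2 rho : 'M[C]_n, density_state rho & A = \tr A *: rho.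
Proof.
move=> n_gt0 psdA; have [trA0 | nz_trA] := eqVneq (\tr A) 0.
  (* The default is the maximally mixed state, which has trace one because n > 0. *)
  exists (n%:R^-1 *: 1%:M).
    split; first by apply: psdmx_scale (psdmx1 _ _); rewrite invr_ge0 ler0n.
    by rewrite mxtraceZ mxtrace1 mulVf // pnatr_eq0 -lt0n.
  by rewrite trA0 scale0r; apply: psdmx_mxtrace_eq0.
exists ((\tr A)^-1 *: A); last by rewrite scalerA divff // scale1r.
split; last by rewrite mxtraceZ mulVf.
by apply: psdmx_scale => //; rewrite invr_ge0 psdmx_mxtrace_ge0.
Qed.

Local Open Scope complex_scope.

Theorem proposition2 (R : realType) (gT : finGroupType) (G : {group gT})
    (K : nat) (cardG : #|G| = K)
    (I : finType) (n : I -> nat)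
    (D : forall a : I, mx_representation R[i] G (n a))
    (completeD : complete_unitary_irreps D)
    (phi : gT -> R[i]) (phi_pos : positive_type G phi)
    (phi1 : phi 1%g = 1) :
  exists (gamma : I -> R) (rho : forall a : I, 'M[R[i]]_(n a)),
    [/\ forall a, 0 <= gamma a,
        \sum_a gamma a = 1,
        forall a, density_state (rho a)
      & forall g, g \in G ->
          phi g = \sum_a (gamma a)%:C * \tr (rho a *m D a g)].
Proof.
have [_ irrD _ _] := completeD.
have [sigma [psd_sigma phiE]] := psd_decomposition completeD phi_pos.
have n_gt0 a : (0 < n a)%N by case/mx_irrP: (irrD a).
have [rho rho_state sigmaE] :=
  fin_all_exists2 (fun a => psdmx_density_state (n_gt0 a) (psd_sigma a)).
(* Taking the real part loses nothing: the trace is nonnegative, hence real. *)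
pose gamma a : R := complex.Re (\tr (sigma a)).
have gammaE a : (gamma a)%:C = \tr (sigma a).
  by rewrite RRe_real // ger0_real // psdmx_mxtrace_ge0.
exists gamma, rho; split=> [a | | a | g Gg].
- by rewrite -(ler0c (gamma a)) gammaE psdmx_mxtrace_ge0.
(* The weights sum to one by evaluating the decomposition at the identity. *)
- apply: (fmorph_inj (real_complex R)); rewrite rmorph_sum rmorph1 -phi1 phiE //.
  by apply: eq_bigr => a _; rewrite /= gammaE repr_mx1 mulmx1.
- exact: rho_state.
rewrite phiE //; apply: eq_bigr => a _.
by rewrite {1}sigmaE -scalemxAl mxtraceZ gammaE.
Qed.
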